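(* Let $X$ be a compact metric space and let $S\subseteq C(X)$ be a function system that separates points of $X$. Given a separable representation $\pi:C(X)\to\mathcal B(H)$, let $\phi:C(X)\to\mathcal B(H)$ be a UCP map such that $\phi(s)-\pi(s)\in\mathcal N_\pi$ for every $s\in S$. If every point of $X$ belongs to the Choquet boundary $\partial_SX$, then $$\phi(f)-\pi(f)\in\mathcal N_\pi\qquad\forall f\in C(X).$$
   Context: A function system $S\subseteq C(X)$ is a linear subspace closed under complex conjugation and containing the constant functions. A point $p\in X$ belongs to the Choquet boundary $\partial_SX$ if the point mass $\delta_p$ is the only Borel probability measure $\mu$ on $X$ with $\int_Xf\,d\mu=f(p)$ for all $f\in S$. UCP means unital completely positive. A representation $\pi:C(X)\to\mathcal B(H)$ is always assumed nondegenerate ($\pi(\mathbf 1)=\mathbf 1$), and is separable if $H$ is a separable Hilbert space. $E$ denotes the spectral measure of $\pi$, the projection-valued measure on Borel subsets of $X$ with $\pi(f)=\int_Xf\,dE$ for $f\in C(X)$. An operator $A\in\mathcal B(H)$ is locally null at $p\in X$ if for every $\epsilon>0$ there is an open neighborhood $U$ of $p$ with $\|AE(U)\|\le\epsilon$ and $\|A^*E(U)\|\le\epsilon$. $A$ is locally null (relative to $\pi$) if it is locally null at every point of $X$, and $\mathcal N_\pi$ denotes the set of all operators in $\mathcal B(H)$ that are locally null relative to $\pi$. *)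

(* Defs.v *)
From HB Require Import structures.
From mathcomp Require Import all_boot all_order all_algebra.
From mathcomp Require Import complex.
From mathcomp Require Import all_classical all_reals all_analysis.

Set Implicit Arguments.
Unset Strict Implicit.
Unset Printing Implicit Defensive.

Import Order.TTheory GRing.Theory Num.Theory.
Import numFieldNormedType.Exports.

Local Open Scope classical_set_scope.
Local Open Scope ring_scope.

(* Metric spaces with a distinguished point: [measurableType] extends
   [pointedType], so a space carrying Borel measures must be nonempty. *)
#[short(type="pointedMetricType")]
HB.structure Definition PointedMetric (K : numDomainType) :=
  { M of Metric K M & isPointed M }.

HB.mixin Record NormedModule_isHilbert (R : realType) H
    & CompleteNormedModule R[i] H := {
  hdot : H -> H -> R[i] ;
  hdot_linear : forall v a u w, hdot (a *: u + w) v = a * hdot u v + hdot w v ;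
  hdotC : forall u v, hdot u v = (hdot v u)^* ;
  hdotE : forall u, hdot u u = `|u| ^+ 2
}.

#[short(type="hilbertType")]
HB.structure Definition Hilbert (R : realType) :=
  { H of CompleteNormedModule R[i] H & NormedModule_isHilbert R H }.

Reserved Notation "''[' u , v ]" (at level 0, format "''[' u ,  v ]").
Notation "''[' u , v ]" := (hdot u v) : ring_scope.

Section HilbertTheory.
Context {R : realType} {H : hilbertType R}.
Implicit Types u v w : H.

Lemma hdotDl u v w : '[u + v, w] = '[u, w] + '[v, w].
Proof. by rewrite -{1}[u]scale1r hdot_linear mul1r. Qed.

Lemma hdotDr u v w : '[u, v + w] = '[u, v] + '[u, w].
Proof. by rewrite hdotC hdotDl rmorphD/= -!hdotC. Qed.

Lemma hdot0l u : '[0, u] = 0.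
Proof. by apply: (addrI '[0, u]); rewrite -hdotDl !addr0. Qed.

Lemma hdot_suml I (r : seq I) (F : I -> H) u :
  '[\sum_(i <- r) F i, u] = \sum_(i <- r) '[F i, u].
Proof.
by elim/big_rec2: _ => [|i y x _ <-]; [exact: hdot0l|exact: hdotDl].
Qed.

Lemma hdot_pythagoras u v :
  '[u, v] = 0 -> '[u + v, u + v] = '[u, u] + '[v, v].
Proof.
move=> uv; rewrite hdotDl !hdotDr uv addr0.
by rewrite (hdotC v u) uv rmorph0 add0r.
Qed.

Lemma RenormE u : (complex.Re `|u|)%:C%C = `|u|.
Proof. exact/RRe_real/normr_real. Qed.

Lemma Re_hdot u : complex.Re '[u, u] = complex.Re `|u| ^+ 2.
Proof. by rewrite hdotE -{1}(RenormE u) -rmorphXn. Qed.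

Lemma Renorm_continuous : continuous (fun u : H => complex.Re `|u| : R).
Proof.
move=> u; apply/cvgrPdist_lt => e e0.
have eC : 0 < e%:C%C :> R[i] by rewrite -[0]/(0%:C%C) ltcR.
have /cvgrPdist_lt/(_ _ eC) : v @[v --> u] --> u by exact: cvg_id.
apply: filterS => v; rewrite -ltcR; apply: le_lt_trans.
apply: le_trans (ler_dist_dist u v).
rewrite -[X in _ <= `|X - _|]RenormE -[X in _ <= `|_ - X|]RenormE -rmorphB/=.
exact: (@normc_ge_Re _ (_)%:C%C).
Qed.
End HilbertTheory.

Definition separable (T : topologicalType) :=
  exists2 D : set T, countable D & dense D.

(* C(X), an algebra over the complex numbers. [R[i]^o] is [R[i]] seen as a
   normed module over itself. *)
Definition cfun (R : realType) (X : topologicalType) := continuousType X R[i]^o.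

Section CFun.
Context {R : realType} {X : ptopologicalType}.
Local Notation C := (R[i]^o).
Local Notation T := (cfun R X).

Definition cfun_pred : {pred X -> C} := mem [set f : X -> C | continuous f].
Definition cfun_key : pred_key cfun_pred. Proof. exact. Qed.
Canonical cfun_keyed := KeyedPred cfun_key.

HB.instance Definition _ := Choice.on T.

Section Sub.
Context (f : X -> C) (fP : f \in cfun_pred).
Definition cfun_Sub : T := mkcts (set_mem fP).
End Sub.

Lemma cfun_rect (K : T -> Type) :
  (forall f (Pf : f \in cfun_pred), K (cfun_Sub Pf)) -> forall u : T, K u.
Proof.
move=> Ksub u; have Pf : (u : X -> C) \in cfun_pred by apply/mem_set/cts_fun.
suff -> : u = cfun_Sub Pf by exact: Ksub.
by apply/continuousEP.
Qed.

Lemma cfun_valP f (Pf : f \in cfun_pred) : cfun_Sub Pf = f :> (_ -> _).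
Proof. by []. Qed.

HB.instance Definition _ := isSub.Build _ _ T cfun_rect cfun_valP.

Lemma cfun_subring_closed : subring_closed cfun_pred.
Proof.
split=> [|f g /set_mem cf /set_mem cg|f g /set_mem cf /set_mem cg];
  apply/mem_set => x.
- exact: cvg_cst.
- by apply: (@cvgB R[i] C); [exact: cf|exact: cg].
- by apply: (@cvgM R[i]); [exact: cf|exact: cg].
Qed.
HB.instance Definition _ :=
  GRing.isSubringClosed.Build _ cfun_pred cfun_subring_closed.
HB.instance Definition _ := [SubChoice_isSubComNzRing of T by <:].

Lemma cfun_scaler_closed : GRing.scaler_closed cfun_pred.
Proof.
move=> a f /set_mem cf; apply/mem_set => x.
by apply: (@cvgM R[i]); [exact: cvg_cst|exact: cf].
Qed.
HB.instance Definition _ :=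
  GRing.isScaleClosed.Build _ _ cfun_pred cfun_scaler_closed.
HB.instance Definition _ := [SubZmodule_isSubLmodule of T by <:].

Lemma cfun_scalerAl (a : R[i]) (f g : T) : a *: (f * g) = (a *: f) * g.
Proof.
apply/continuousEP => x.
by rewrite -[LHS]/(a * (f x * g x)) -[RHS]/((a * f x) * g x) mulrA.
Qed.
HB.instance Definition _ :=
  GRing.LSemiModule_isLSemiAlgebra.Build R[i] T cfun_scalerAl.

Lemma cfun_conj_continuous (f : T) : continuous (fun x => (f x)^* : C).
Proof.
move=> x; apply/(@cvgrPdist_lt _ C) => e e0.
have /(@cvgrPdist_lt _ C)/(_ e e0) := @cts_fun _ _ f x.
by apply: filterS => y; rewrite -rmorphB norm_conjC.
Qed.

Definition cfun_conj (f : T) : T := mkcts (@cfun_conj_continuous f).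
End CFun.

(* B(H): continuous (i.e. bounded) linear maps; the product is composition. *)
Section BoundedOperators.
Context {R : realType} {H : hilbertType R}.

Definition bop_pred : {pred H -> H} :=
  mem [set f : H -> H | linear f /\ continuous f].
Definition bop_key : pred_key bop_pred. Proof. exact. Qed.
Canonical bop_keyed := KeyedPred bop_key.

Record bop := BOp { bop_fun :> H -> H ; bop_funP : bop_fun \in bop_pred }.

HB.instance Definition _ := [isSub for bop_fun].
HB.instance Definition _ := [Choice of bop by <:].

Lemma bopP (A B : bop) : A = B <-> A =1 B.
Proof. by split=> [->//|AB]; apply/val_inj/funext. Qed.

Lemma bop_linear (A : bop) : linear A.
Proof. by have /set_mem[] := bop_funP A. Qed.
HB.instance Definition _ (A : bop) :=
  GRing.isLinear.Build R[i] H H *:%R A (bop_linear A).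

Lemma bop_continuous (A : bop) : continuous A.
Proof. by have /set_mem[] := bop_funP A. Qed.
HB.instance Definition _ (A : bop) :=
  isContinuous.Build H H A (@bop_continuous A).

Lemma bop_submod_closed : submod_closed bop_pred.
Proof.
split=> [|a f g /set_mem[lf cf] /set_mem[lg cg]]; apply/mem_set.
  split=> [a u v|u]; last exact: cvg_cst.
  by rewrite [RHS]addr0 scaler0.
split=> [b u v|u].
  rewrite [LHS]/GRing.add/= [X in X + _]/GRing.scale/= lf lg.
  rewrite [in RHS]/GRing.add/= [X in _ = b *: (X + _) + _]/GRing.scale/=.
  by rewrite !scalerDr !scalerA mulrC addrACA.
by apply: cvgD; [apply: cvgZr; exact: cf|exact: cg].
Qed.
HB.instance Definition _ :=
  GRing.isSubmodClosed.Build _ _ bop_pred bop_submod_closed.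
HB.instance Definition _ := [SubChoice_isSubLmodule of bop by <:].

Lemma bop_id_subproof : (@idfun H) \in bop_pred.
Proof. by apply/mem_set; split=> // u; exact: cvg_id. Qed.
Definition bop_id := BOp bop_id_subproof.

Lemma bop_comp_subproof (A B : bop) : A \o B \in bop_pred.
Proof.
apply/mem_set; split=> [a u v|u]; first by rewrite /= !linearP.
by apply: continuous_comp; exact: bop_continuous.
Qed.
Definition bop_comp (A B : bop) := BOp (bop_comp_subproof A B).

Lemma bop_compA : associative bop_comp.
Proof. by move=> A B D; apply/bopP. Qed.
Lemma bop_comp1l : left_id bop_id bop_comp.
Proof. by move=> A; apply/bopP. Qed.
Lemma bop_comp1r : right_id bop_id bop_comp.
Proof. by move=> A; apply/bopP. Qed.
Lemma bop_compDl : left_distributive bop_comp +%R.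
Proof. by move=> A B D; apply/bopP. Qed.
Lemma bop_compDr : right_distributive bop_comp +%R.
Proof. by move=> A B D; apply/bopP => u; exact: (linearD A). Qed.
HB.instance Definition _ := GRing.Zmodule_isPzRing.Build bop
  bop_compA bop_comp1l bop_comp1r bop_compDl bop_compDr.

Definition opnorm (A : bop) : R :=
  sup [set complex.Re `|A u| | u in [set u : H | `|u| <= 1]].

Definition is_adjoint (A B : bop) := forall u v, '[A u, v] = '[u, B v].

(* By the Riesz representation theorem the adjoint exists, and it is unique: the
   default value 0 is never used. *)
Definition adjoint (A : bop) : bop := xget 0 [set B | is_adjoint A B].
End BoundedOperators.
Arguments bop {R} H.

Definition borel (X : ptopologicalType) := g_sigma_algebraType (@open X).

Definition cintegral (R : realType) (X : ptopologicalType)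
    (mu : {measure set (borel X) -> \bar R}) (f : cfun R X) : R[i] :=
  ((\int[mu]_x complex.Re (f x)) +i* (\int[mu]_x complex.Im (f x)))%C.

Section FunctionSystem.
Context {R : realType} {X : ptopologicalType}.
Implicit Types S : set (cfun R X).

Record function_system S : Prop := {
  function_systemP : forall (a : R[i]) f g, S f -> S g -> S (a *: f + g) ;
  function_system_conj : forall f, S f -> S (cfun_conj f) ;
  function_system_const : forall a : R[i], S (a *: 1) }.

Definition separates_points_of S :=
  forall x y : X, x != y -> exists2 f, S f & f x != f y.

Definition choquet_boundary S : set X :=
  [set p | forall mu : probability (borel X) R,
     (forall f, S f -> cintegral mu f = f p) ->
     forall B : set (borel X), measurable B -> mu B = \d_(p : borel X) B].
End FunctionSystem.

Section Maps.
Context {R : realType} {X : ptopologicalType} {H : hilbertType R}.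

(* A representation is a *-preserving [{lrmorphism cfun R X -> bop H}]; being
   unital, it is nondegenerate. *)
Definition star_preserving (pi : cfun R X -> bop H) :=
  forall f, is_adjoint (pi f) (pi (cfun_conj f)).

(* Positivity in the C*-algebra of n x n matrices over C(X): F = G^* G. *)
Definition cfun_mx_nonneg n (F : 'M[cfun R X]_n) :=
  exists G : 'M[cfun R X]_n, F = (map_mx cfun_conj G)^T *m G.

(* Positivity of a matrix of operators acting on the direct sum H^n. *)
Definition bop_mx_nonneg n (T : 'M[bop H]_n) :=
  forall u : 'I_n -> H, 0 <= \sum_i '[\sum_j T i j (u j), u i].

Definition completely_positive (phi : cfun R X -> bop H) :=
  forall n (F : 'M[cfun R X]_n), cfun_mx_nonneg F -> bop_mx_nonneg (map_mx phi F).

Definition ucp (phi : cfun R X -> bop H) :=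
  phi 1 = 1 /\ completely_positive phi.
End Maps.

Section PVM.
Context {R : realType} (X : ptopologicalType) (H : hilbertType R).

Record pvm := PVM {
  pvm_fun :> set (borel X) -> bop H ;
  pvm_adj : forall A, measurable A -> is_adjoint (pvm_fun A) (pvm_fun A) ;
  pvm0 : pvm_fun set0 = 0 ;
  pvmT : pvm_fun setT = 1 ;
  pvmI : forall A B, measurable A -> measurable B ->
    pvm_fun (A `&` B) = pvm_fun A * pvm_fun B ;
  pvm_sigma_additive : forall (F : (set (borel X))^nat) (u : H),
    (forall n, measurable (F n)) -> trivIset setT F ->
    (fun n => \sum_(0 <= k < n) pvm_fun (F k) u) @ \oo
      --> pvm_fun (\bigcup_n F n) u }.

(* The measure B |-> '[E B u, u]; on Borel sets, where E B is a projection, this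
   is the squared norm of E B u. *)
Definition pvm_measure (E : pvm) (u : H) (B : set (borel X)) : \bar R :=
  (complex.Re `|E B u| ^+ 2)%:E.

Section Measure.
Context (E : pvm) (u : H).
Local Notation mu := (pvm_measure E u).

Let mu0 : mu set0 = 0%E.
Proof. by rewrite /pvm_measure pvm0 normr0 expr0n. Qed.

Let mu_ge0 B : (0 <= mu B)%E.
Proof. by rewrite lee_fin sqr_ge0. Qed.

Let pvm_sum (F : (set (borel X))^nat) n :
  (forall n, measurable (F n)) -> trivIset setT F ->
  '[\sum_(0 <= k < n) E (F k) u, \sum_(0 <= k < n) E (F k) u] =
  \sum_(0 <= k < n) '[E (F k) u, E (F k) u].
Proof.
move=> mF tF; elim: n => [|n ih]; first by rewrite !big_geq// hdot0l.
rewrite !big_nat_recr//= -ih; apply: hdot_pythagoras.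
rewrite hdot_suml big_nat big1// => k /= kn.
rewrite -(pvm_adj E (mF n)).
rewrite -[E (F n) (E (F k) u)]/((E (F n) * E (F k)) u) -pvmI//.
have /trivIsetP/(_ n k I I) -> := tF; last by rewrite gtn_eqF.
by rewrite pvm0 hdot0l.
Qed.

Let mu_sigma_additive : semi_sigma_additive mu.
Proof.
move=> F mF tF _; rewrite /pvm_measure.
have cE := cvg_comp _ _ (@pvm_sigma_additive E F u mF tF)
  (@Renorm_continuous R H _).
under eq_fun do rewrite sumEFin.
apply: cvg_EFin; first exact: nearW.
rewrite expr2; apply: cvg_trans (cvgM cE cE).
apply: near_eq_cvg; apply: nearW => n /=.
rewrite -expr2 -Re_hdot pvm_sum// raddf_sum.
by apply: eq_bigr => k _; exact: Re_hdot.
Qed.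
HB.instance Definition _ :=
  isMeasure.Build _ _ _ mu mu0 mu_ge0 mu_sigma_additive.
End Measure.
End PVM.

Section LocallyNull.
Context {R : realType} {X : ptopologicalType} {H : hilbertType R}.

(* E is the spectral measure of pi: the operator pi f is the integral of f
   against E, which means that '[pi f u, u] is the integral of f against the
   measure B |-> '[E B u, u], for every u. *)
Definition is_spectral_measure (pi : cfun R X -> bop H) (E : pvm X H) :=
  forall f u, '[pi f u, u] = cintegral (pvm_measure E u) f.

Definition locally_null_at (E : pvm X H) (A : bop H) (p : X) :=
  forall e : R, 0 < e -> exists U : set X,
    [/\ open U, U p, opnorm (A * E U) <= e & opnorm (adjoint A * E U) <= e].

Definition locally_null (E : pvm X H) : set (bop H) :=
  [set A | forall p, locally_null_at E A p].
End LocallyNull.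

(* Main.v *)
Require Import Defs.
From HB Require Import structures.
From mathcomp Require Import all_boot all_order all_algebra.
From mathcomp Require Import complex.
From mathcomp Require Import all_classical all_reals all_analysis.
From mathcomp Require Import finmap ring lra measurable_realfun.

Import Order.TTheory GRing.Theory Num.Theory.
Import numFieldNormedType.Exports.

Local Open Scope classical_set_scope.
Local Open Scope ring_scope.

(* Suppose [phi f - pi f] is not locally null at [p]. By the Schwarz inequality
   [|phi g w|^2 <= <phi (|g|^2) w, w>] for [g = f - f p], there are a continuous
   [h >= 0] vanishing at [p] and unit vectors [w_n] in the range of the spectral
   projections of the balls [B(p, 1/n)] such that [<phi h w_n, w_n>] stays away
   from 0. An ultrafilter limit of the states [<phi (.) w_n, w_n>] agrees with
   the evaluation at [p] on [S], because [phi s - pi s] is locally null at [p]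
   for [s] in [S]. By the Riesz representation theorem this limit is given by a
   probability measure, which has to be [\d_p] as [p] is in the Choquet boundary;
   so its value at [h] is [h p = 0]. *)

(** * Real continuous functions, Borel sets and states *)

Section ContinuousFunctions.
Context {R : realType} {X : topologicalType}.

Lemma cst_fun_continuous (a : R) : continuous (fun _ : X => a).
Proof. by move=> x; exact: cvg_cst. Qed.

Lemma add_fun_continuous (f g : X -> R) : continuous f -> continuous g ->
  continuous (fun x => f x + g x).
Proof. by move=> cf cg x; apply: cvgD; [exact: cf|exact: cg]. Qed.

Lemma scale_fun_continuous (a : R) (f : X -> R) : continuous f ->
  continuous (fun x => a * f x).
Proof. by move=> cf x; apply: cvgM; [exact: cvg_cst|exact: cf]. Qed.

Lemma sum_fun_continuous n (F : nat -> X -> R) : (forall i, continuous (F i)) ->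
  continuous (fun x => \sum_(i < n) F i x).
Proof.
move=> cF; elim: n => [|n ih].
  under [X in continuous X]eq_fun do rewrite big_ord0.
  exact: cst_fun_continuous.
under [X in continuous X]eq_fun do rewrite big_ord_recr/=.
exact: add_fun_continuous.
Qed.

Lemma open_lt_fun (f g : X -> R) : continuous f -> continuous g ->
  open [set x | f x < g x].
Proof.
move=> cf cg.
rewrite (_ : [set _ | _] = (fun x => g x + -1 * f x) @^-1` [set r | 0 < r]).
  apply: open_comp; last exact: open_gt.
  by move=> x _; apply: add_fun_continuous => //; exact: scale_fun_continuous.
by apply/funext => x; rewrite /= mulN1r subr_gt0.
Qed.

Lemma compact_continuous_bounded (f : X -> R) :
  compact [set: X] -> continuous f -> exists2 M, 0 < M & forall x, `|f x| <= M.
Proof.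
move=> cX cf; have : compact (f @` [set: X]).
  by apply: continuous_compact => //; exact: continuous_subspaceT.
move=> /compact_bounded[M [_ fM]]; exists (`|M| + 1) => [|x].
  by rewrite ltr_wpDl.
by apply: fM; [rewrite ltr_pwDr// ler_norm|exists x].
Qed.
End ContinuousFunctions.

Section BorelSets.
Context {R : realType} {X : ptopologicalType}.

Lemma open_borel (U : set X) : open U -> measurable (U : set (borel X)).
Proof. exact: sub_gen_smallest. Qed.

Lemma borel_measurable_fun (f : X -> R) : continuous f ->
  measurable_fun setT (f : borel X -> R).
Proof.
move=> cf; apply: (measurability _ (RGenOInfty.measurableE R)) => _ [_ [a ->] <-].
rewrite setTI; apply: open_borel.
by apply: open_comp => [x _|]; [exact: cf|exact: interval_open].
Qed.

Lemma continuous_integrable (mu : {measure set (borel X) -> \bar R})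
    (f : X -> R) : compact [set: X] -> (mu setT < +oo)%E -> continuous f ->
  mu.-integrable setT (EFin \o f).
Proof.
move=> cX muT cf; have [M M0 fM] := compact_continuous_bounded _ cX cf.
apply: measurable_bounded_integrable => //.
- exact: borel_measurable_fun.
- exists M; split => [|r Mr x _]; first exact: num_real.
  exact: le_trans (fM x) (ltW Mr).
Qed.
End BorelSets.

(* The functional is defined on all functions, but constrained only on the
   continuous ones. *)
Record is_state {R : realType} {X : topologicalType} (L : (X -> R) -> R) : Prop := {
  is_stateD : forall f g : X -> R, continuous f -> continuous g ->
    L (fun x => f x + g x) = L f + L g ;
  is_stateZ : forall (a : R) (f : X -> R), continuous f ->
    L (fun x => a * f x) = a * L f ;
  is_state_ge0 : forall f : X -> R, continuous f -> (forall x, 0 <= f x) ->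
    0 <= L f ;
  is_state1 : L (fun=> 1) = 1 }.
Arguments is_stateD {R X L}.
Arguments is_stateZ {R X L}.
Arguments is_state_ge0 {R X L}.
Arguments is_state1 {R X L}.

Section States.
Context {R : realType} {X : topologicalType}.

Lemma is_state_le (L : (X -> R) -> R) (f g : X -> R) : is_state L ->
  continuous f -> continuous g -> (forall x, f x <= g x) -> L f <= L g.
Proof.
move=> sL cf cg fg; rewrite -subr_ge0 -mulN1r.
have cNf := scale_fun_continuous (-1) f cf.
rewrite -(is_stateZ sL)// -(is_stateD sL)//; apply: (is_state_ge0 sL) => [|x].
  exact: add_fun_continuous.
by rewrite mulN1r subr_ge0.
Qed.

Lemma is_state_cst (L : (X -> R) -> R) a : is_state L -> L (fun=> a) = a.
Proof.
move=> sL; rewrite -[RHS]mulr1 -(is_state1 sL) -(is_stateZ sL); last first.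
  exact: cst_fun_continuous.
by congr L; apply/funext => x; rewrite mulr1.
Qed.

Lemma is_state_sum (L : (X -> R) -> R) n (F : nat -> X -> R) : is_state L ->
  (forall i, continuous (F i)) ->
  L (fun x => \sum_(i < n) F i x) = \sum_(i < n) L (F i).
Proof.
move=> sL cF; elim: n => [|n ih].
  rewrite big_ord0 -[RHS](is_state_cst _ 0 sL); congr L.
  by apply/funext => x; rewrite big_ord0.
rewrite big_ord_recr/= -ih -(is_stateD sL)//; last exact: sum_fun_continuous.
by congr L; apply/funext => x; rewrite big_ord_recr.
Qed.

End States.

(** * Riesz representation on a compact metric space *)

Section Gap.
Context {R : realType} {X : pointedMetricType R}.
Implicit Types (U : set X) (x y : X).

(* The distance from [x] to the complement of [U], truncated at 1 so that the
   infimum is over a nonempty set even if [U] is the whole space. *)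
Definition gap U x : R := inf ([set 1] `|` [set mdist x y | y in ~` U]).

Let gap_lb U x : has_inf ([set 1] `|` [set mdist x y | y in ~` U] : set R).
Proof.
split; first by exists 1; left.
by exists 0 => _ [->//|[y _ <-]]; exact: mdist_ge0.
Qed.

Lemma gap_ge0 U x : 0 <= gap U x.
Proof.
apply: lb_le_inf => [|_ [->//|[y _ <-]]]; last exact: mdist_ge0.
by exists 1; left.
Qed.

Lemma gap_eq0 U x : ~ U x -> gap U x = 0.
Proof.
move=> Ux; apply/eqP; rewrite eq_le gap_ge0 andbT -(mdistxx x).
by apply: ge_inf; [exact: (gap_lb _ _).2|right; exists x].
Qed.

Lemma gap_gt0 U x : open U -> U x -> 0 < gap U x.
Proof.
move=> oU Ux; have /nbhs_ballP[e /= e0 xeU] : nbhs x U by exact: open_nbhs_nbhs.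
apply: (@lt_le_trans _ _ (Num.min 1 e)); first by rewrite lt_min ltr01.
apply: lb_le_inf => [|_ [->|[y Uy <-]]]; first by exists 1; left.
  by rewrite ge_min lexx.
rewrite ge_min; apply/orP; right; rewrite leNgt; apply/negP => xye.
by apply/Uy/xeU; rewrite ballEmdist.
Qed.

(** Half of the 1-Lipschitz bound; exchanging [x] and [y] gives the other half, hence continuity. *)
Lemma gap_triangle U x y : gap U x <= mdist x y + gap U y.
Proof.
rewrite -lerBlDl; apply: lb_le_inf => [|_ [->|[z Uz <-]]].
- by exists 1; left.
- rewrite lerBlDr ler_wpDr ?mdist_ge0//.
  by apply: ge_inf; [exact: (gap_lb _ _).2|left].
- rewrite lerBlDl (le_trans _ (metric_triangle x y z))//.
  by apply: ge_inf; [exact: (gap_lb _ _).2|right; exists z].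
Qed.

Lemma gap_continuous U : continuous (gap U).
Proof.
move=> x; apply/cvgrPdist_lt => e e0; near=> y.
have xye : mdist x y < e.
  have : ball x e y by near: y; exact: nbhsx_ballx.
  by rewrite ballEmdist.
rewrite ltr_norml; apply/andP; split.
  rewrite ltrNl opprB; have := gap_triangle U y x; rewrite metric_sym; lra.
have := gap_triangle U x y; lra.
Unshelve. all: by end_near. Qed.

(** For open [U] these functions increase with [n] to the indicator of [U], and each point of [U]
    sees the value 1 at a finite stage. *)
Definition plateau (n : nat) U x : R := Num.min 1 (n%:R * gap U x).

Lemma plateau_continuous n U : continuous (plateau n U).
Proof.
move=> x; apply: (@continuous_min R X (fun=> 1) (fun x => n%:R * gap U x) x).
  exact: cvg_cst.
by apply: cvgM; [exact: cvg_cst|exact: gap_continuous].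
Qed.

Lemma plateau_ge0 n U x : 0 <= plateau n U x.
Proof. by rewrite le_min ler01 mulr_ge0// gap_ge0. Qed.

Lemma plateau_le1 n U x : plateau n U x <= 1.
Proof. by rewrite ge_min lexx. Qed.

Lemma plateau_out n U x : ~ U x -> plateau n U x = 0.
Proof. by move=> Ux; rewrite /plateau gap_eq0// mulr0 min_r. Qed.

Lemma plateau_mono m n U x : (m <= n)%N -> plateau m U x <= plateau n U x.
Proof.
move=> mn; rewrite le_min plateau_le1/= ge_min; apply/orP; right.
by rewrite ler_wpM2r ?gap_ge0// ler_nat.
Qed.

Lemma plateau_eventually1 U x : open U -> U x ->
  exists n, forall m, (n <= m)%N -> plateau m U x = 1.
Proof.
move=> oU Ux; have g0 := gap_gt0 U x oU Ux.
exists (Num.truncn (gap U x)^-1).+1 => m nm; apply/eqP.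
rewrite eq_le plateau_le1/= le_min lexx/= -ler_pdivrMr// mul1r.
apply: le_trans (ltW (truncnS_gt _)) _.
by rewrite ler_nat.
Qed.
End Gap.

Section RieszMarkov.
Context {R : realType} {X : pointedMetricType R} (L : (X -> R) -> R).
Hypothesis cX : compact [set: X].
Hypothesis sL : is_state L.

Let LD := is_stateD sL.
Let LZ := is_stateZ sL.
Let L1 := is_state1 sL.

Let cstC (a : R) : continuous (fun _ : X => a).
Proof. exact: cst_fun_continuous. Qed.

Let L_cst a : L (fun=> a) = a.
Proof. exact: is_state_cst. Qed.

Let L_le (f g : X -> R) : continuous f -> continuous g ->
  (forall x, f x <= g x) -> L f <= L g.
Proof. exact: is_state_le. Qed.

Let L_sum n (F : nat -> X -> R) : (forall i, continuous (F i)) ->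
  L (fun x => \sum_(i < n) F i x) = \sum_(i < n) L (F i).
Proof. exact: is_state_sum. Qed.

(** Continuous functions between 0 and the indicator of [U]. They vanish off [U], but their support
    may reach the boundary of [U]. *)
Definition minorant (U : set X) : set (X -> R) :=
  [set f : X -> R | [/\ continuous f, forall x, 0 <= f x <= 1 &
    forall x, ~ U x -> f x = 0]].

(** As in the classical construction, open sets are measured from inside by [L], and arbitrary sets
    from outside by open sets. *)
Definition inner_mass (U : set X) : \bar R :=
  ereal_sup [set (L f)%:E | f in minorant U].

Definition outer_mass (A : set X) : \bar R :=
  ereal_inf [set inner_mass U | U in [set U | open U /\ A `<=` U]].

Let minorant0 U : minorant U (fun=> 0).
Proof. by split=> // x; rewrite lexx ler01. Qed.

Let minorantS U V : U `<=` V -> minorant U `<=` minorant V.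
Proof. by move=> UV f [cf f01 fU]; split => // x Vx; apply: fU => /UV. Qed.

Let inner_le U f : minorant U f -> ((L f)%:E <= inner_mass U)%E.
Proof. by move=> Uf; apply: ereal_sup_ubound; exists f. Qed.

Let inner_ge0 U : (0 <= inner_mass U)%E.
Proof. by have := inner_le U _ (minorant0 U); rewrite L_cst. Qed.

Let innerS U V : U `<=` V -> (inner_mass U <= inner_mass V)%E.
Proof.
move=> UV; apply: ge_ereal_sup => _ [f Uf <-].
exact/inner_le/(minorantS _ _ UV).
Qed.

Let inner_le1 U : (inner_mass U <= 1)%E.
Proof.
apply: ge_ereal_sup => _ [f [cf f01 _] <-]; rewrite lee_fin -[leRHS]L1.
by apply: L_le => // x; have /andP[] := f01 x.
Qed.

Let inner_fin U : inner_mass U \is a fin_num.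
Proof.
by rewrite ge0_fin_numE//; apply: le_lt_trans (inner_le1 U) _; rewrite ltry.
Qed.

Let minorant_plateau n U : minorant U (plateau n U).
Proof.
split => [|x|x]; first exact: plateau_continuous.
  by rewrite plateau_ge0 plateau_le1.
exact: plateau_out.
Qed.

(* As in Dini's theorem: the sums of the plateaus of the first k sets increase
   with k, and exceed the indicator of the union in the limit. *)
Let minorant_bigcup (U : nat -> set X) f (e : R) : (forall i, open (U i)) ->
  minorant (\bigcup_i U i) f -> 0 < e ->
  exists k, forall x, f x < \sum_(i < k) plateau k (U i) x + e.
Proof.
move=> oU [cf f01 fU] e0.
pose V k := [set x : X | f x < \sum_(i < k) plateau k (U i) x + e].
have VS j k : (j <= k)%N -> V j `<=` V k.
  move=> jk x; rewrite /V/= => /lt_le_trans; apply; rewrite lerD2r.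
  rewrite -[leRHS](big_mkord xpredT (fun i => plateau k (U i) x)).
  rewrite (big_cat_nat (leq0n j) jk)/= big_mkord -[leLHS]addr0 lerD//.
    by apply: ler_sum => i _; exact: plateau_mono.
  by apply: sumr_ge0 => i _; exact: plateau_ge0.
have := cX; rewrite compact_cover => /(_ nat setT V)[k _|x _|D _ Dcov].
- apply: open_lt_fun => //; apply: add_fun_continuous => //.
  apply: (sum_fun_continuous k (fun i => plateau k (U i))) => i.
  exact: plateau_continuous.
- have [[i _ Uix]|nUx] := pselect ((\bigcup_i U i) x); last first.
    exists 0%N => //; rewrite /V/= big_ord0 fU// add0r//.
  have [n nU] := plateau_eventually1 (U i) x (oU i) Uix.
  (* The index must be at least [n], for the plateau of [U i] to be 1 at [x], and above [i], for
     this plateau to occur in the sum. *)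
  exists (maxn n i.+1) => //; rewrite /V/=.
  have im : (i < maxn n i.+1)%N by rewrite leq_max ltnSn orbT.
  rewrite (bigD1 (Ordinal im))//= nU ?leq_maxl//.
  have /andP[_ f1] := f01 x; rewrite -addrA (le_lt_trans f1)// ltrDl.
  by rewrite ltr_wpDl// sumr_ge0// => j _; exact: plateau_ge0.
- exists (\max_(i <- D) i) => x; have [i /= iD] := Dcov x I.
  by apply: VS; exact: (@leq_bigmax_seq _ _ predT (fun i : nat => i)).
Qed.

(** Applying [L] to the uniform bound of [minorant_bigcup] bounds [L f], up to [e], by a finite sum
    of values of [L] on minorants of the sets [U i]. *)
Let inner_bigcup (U : nat -> set X) : (forall i, open (U i)) ->
  (inner_mass (\bigcup_i U i) <= \sum_(i <oo) inner_mass (U i))%E.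
Proof.
move=> oU; apply: ge_ereal_sup => _ [f Uf <-]; apply/lee_addgt0Pr => e e0.
have [k fk] := minorant_bigcup _ _ _ oU Uf e0.
have cp i : continuous (plateau k (U i)) by exact: plateau_continuous.
apply: (@le_trans _ _ (\sum_(i < k) (L (plateau k (U i)))%:E + e%:E)%E).
  rewrite sumEFin -EFinD lee_fin -(L_sum k (fun i => plateau k (U i)))//.
  have cs := sum_fun_continuous k (fun i => plateau k (U i)) cp.
  rewrite -[X in _ <= _ + X]L_cst -LD//.
  by apply: L_le => [|| x]; [case: Uf|exact: add_fun_continuous|exact/ltW].
rewrite leeD2r//.
apply: (@le_trans _ _ (\sum_(i < k) inner_mass (U i))%E).
  by apply: lee_sum => i _; exact: inner_le.
rewrite -(big_mkord xpredT (fun i => inner_mass (U i))).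
exact: nneseries_lim_ge.
Qed.

Let outer_open U : open U -> outer_mass U = inner_mass U.
Proof.
move=> oU; apply/eqP; rewrite eq_le; apply/andP; split.
  by apply: ereal_inf_lbound; exists U; first by split.
by apply: le_ereal_inf_tmp => _ [V [_ UV] <-]; exact: innerS.
Qed.

Let outer_ge0 A : (0 <= outer_mass A)%E.
Proof. by apply: le_ereal_inf_tmp => _ [V _ <-]. Qed.

Let outerS A B : A `<=` B -> (outer_mass A <= outer_mass B)%E.
Proof.
move=> AB; apply: ereal_inf_le_tmp => _ [V [oV BV] <-].
by exists V => //; split => //; exact: subset_trans BV.
Qed.

Let outer0 : outer_mass set0 = 0%E.
Proof.
rewrite (outer_open _ open0); apply/eqP; rewrite eq_le inner_ge0 andbT.
apply: ge_ereal_sup => _ [f [_ _ f0] <-]; rewrite (_ : f = fun=> 0) ?L_cst//.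
by apply/funext => x; rewrite f0.
Qed.

Let outer_fin A : outer_mass A \is a fin_num.
Proof.
rewrite ge0_fin_numE//; apply: (@le_lt_trans _ _ (inner_mass setT)).
  by rewrite -(outer_open _ openT); exact: outerS.
by rewrite ltey_eq inner_fin.
Qed.

Let outer_adherent A (e : R) : 0 < e ->
  exists U, [/\ open U, A `<=` U & (inner_mass U <= outer_mass A + e%:E)%E].
Proof.
move=> e0; have [_ [U [oU AU] <-] Ue] := lb_ereal_inf_adherent e0 (outer_fin A).
by exists U; split => //; exact: ltW.
Qed.

(** Each [A n] is enclosed in an open set with excess [e / 2 ^ n.+1]; the excesses sum to [e], which
    reduces the claim to [inner_bigcup]. *)
Let outer_sigma_subadditive : sigma_subadditive outer_mass.
Proof.
move=> A; apply/lee_addgt0Pr => e e0.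
apply: le_trans _ (epsilon_trick _ _ (ltW e0)) => //.
have /choice[U AU] n : exists U, [/\ open U, A n `<=` U &
    (inner_mass U <= outer_mass (A n) + (e / (2 ^ n.+1)%:R)%:E)%E].
  by apply: outer_adherent; rewrite divr_gt0// ltr0n expn_gt0.
apply: (@le_trans _ _ (inner_mass (\bigcup_n U n))).
  apply: ereal_inf_lbound; exists (\bigcup_n U n) => //; split.
    by apply: bigcup_open => n _; have [] := AU n.
  by move=> x [n _ Ax]; exists n => //; have [_ + _] := AU n; apply.
apply: (le_trans (inner_bigcup _ _)) => [n|]; first by have [] := AU n.
by apply: lee_nneseries => n // _; have [] := AU n.
Qed.

HB.instance Definition _ := isOuterMeasure.Build R X outer_mass
  outer0 outer_ge0 outerS outer_sigma_subadditive.

(* If [f] nearly exhausts the mass of [V `&` U], the cut-off [max 0 (f - e)] is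
   supported in the closed set [f >= e], so any minorant of [V] off this set can be
   added to it. *)
Let open_caratheodory U : open U -> outer_mass.-caratheodory U.
Proof.
move=> oU; apply: le_caratheodory_measurable => A.
(* The mass of [A] is an infimum over open [V] containing [A], and replacing [A] by [V] only
   enlarges the two parts; so it suffices to split [V]. *)
apply: le_ereal_inf_tmp => _ [V [oV AV] <-].
have oVU : open (V `&` U) by exact: openI.
apply: (@le_trans _ _ (inner_mass (V `&` U) + outer_mass (V `&` ~` U))%E).
  by apply: leeD; [rewrite -outer_open//; apply: outerS; exact: setSI|
                   apply: outerS; exact: setSI].
rewrite -leeBrDr; last exact: outer_fin.
apply: ge_ereal_sup => _ [f [cf f01 fVU] <-].
rewrite leeBrDr; last exact: outer_fin.
apply/lee_addgt0Pr => e e0.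
pose K := [set x | e <= f x]; pose W := V `&` ~` K.
have oW : open W.
  apply: openI => //; apply: closed_openC.
  rewrite (_ : K = f @^-1` [set r | e <= r])//.
  by apply: closed_comp; [move=> x _; exact: cf|exact: closed_ge].
have KVU x : K x -> (V `&` U) x.
  rewrite /K/= => efx; apply: contrapT => /fVU fx.
  by move: efx; rewrite fx leNgt e0.
pose h x := Num.max 0 (f x - e).
have ch : continuous h.
  move=> x; apply: (@continuous_max R X (fun=> 0) (fun x => f x - e) x).
    exact: cvg_cst.
  by apply: cvgB; [exact: cf|exact: cvg_cst].
have fh x : f x <= h x + e by rewrite -lerBlDr le_max lexx orbT.
have h0 x : 0 <= h x by rewrite le_max lexx.
have hK x : ~ K x -> h x = 0.
  by rewrite /K/= => /negP; rewrite -ltNge => /ltW fe; rewrite /h max_l// subr_le0.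
have h1 x : h x <= 1.
  by rewrite ge_max ler01/= lerBlDr; have /andP[_ ] := f01 x; lra.
have Lf : L f <= L h + e.
  rewrite -[X in _ + X]L_cst -LD//.
  by apply: L_le => //; exact: add_fun_continuous.
(* For a minorant [g] of [W], the sum [h + g] is a minorant of [V]: [g] vanishes on [K], [h]
   vanishes off [K], and both are at most 1. *)
have : (inner_mass W <= inner_mass V - (L h)%:E)%E.
  apply: ge_ereal_sup => _ [g [cg g01 gW] <-].
  rewrite leeBrDr// addeC -EFinD -LD//; apply: inner_le; split.
  - exact: add_fun_continuous.
  - move=> x; have /andP[g0 g1] := g01 x; rewrite addr_ge0//=.
    have [Kx|Kx] := pselect (K x); last by rewrite hK// add0r.
    by rewrite gW ?addr0// => -[].
  - move=> x Vx; rewrite gW ?addr0; last by move=> [].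
    by apply: hK => /KVU[].
rewrite leeBrDr// => LWV.
apply: (@le_trans _ _ ((L h + e)%:E + inner_mass W)%E).
  apply: leeD; first by rewrite lee_fin.
  (* [K] lies in [U], hence [W] contains the part of [V] off [U]. *)
  rewrite -outer_open//; apply: outerS => x [Vx Ux]; split => // /KVU[_].
  exact: Ux.
rewrite EFinD -addeA addeCA addeA [leRHS]addeC -addeA leeD2l//.
by rewrite addeC.
Qed.

Let borel_caratheodory (B : set (borel X)) :
  measurable B -> outer_mass.-cara.-measurable B.
Proof.
apply: smallest_sub; last by move=> U; exact: open_caratheodory.
exact: sigma_algebra_measurable.
Qed.

Definition riesz_measure (B : set (borel X)) : \bar R := outer_mass B.

Let riesz_sigma_additive : semi_sigma_additive riesz_measure.
Proof.
move=> F mF tF mUF; rewrite /riesz_measure.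
apply: (@caratheodory_measure_sigma_additive R X outer_mass) => //.
  by move=> n; exact: borel_caratheodory.
exact: borel_caratheodory.
Qed.

HB.instance Definition _ := isMeasure.Build _ _ _ riesz_measure
  outer0 outer_ge0 riesz_sigma_additive.

Let riesz_setT : riesz_measure setT = 1%E.
Proof.
rewrite /riesz_measure (outer_open _ openT); apply/eqP; rewrite eq_le inner_le1/=.
rewrite -[X in (X%:E <= _)%E]L1; apply: inner_le.
by split=> [//|x|x /(_ I)//]; rewrite ler01 lexx.
Qed.

HB.instance Definition _ :=
  Measure_isProbability.Build _ _ _ riesz_measure riesz_setT.

(** The [k]-th term is the length of the part of the segment from 0 to [t] that lies between [k] and
    [k + 1]. *)
Let slice_sum (t : R) m : 0 <= t ->
  \sum_(k < m) Num.min 1 (Num.max 0 (t - k%:R)) = Num.min m%:R t.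
Proof.
move=> t0; elim: m => [|m ih]; first by rewrite big_ord0 min_l.
rewrite big_ord_recr/= {}ih -natr1; have m0 : 0 <= m%:R :> R by rewrite ler0n.
have [tm|/ltW mt] := leP t m%:R.
  rewrite [Num.max _ _]max_l ?subr_le0// [Num.min 1 _]min_r// addr0.
  by rewrite !min_r//; lra.
rewrite [Num.max _ _]max_r ?subr_ge0//.
have [tm|tm] := leP t (m%:R + 1); last by rewrite min_l; lra.
by rewrite min_r; lra.
Qed.

(** The sum counts the integers [k < m] below [t], and there are fewer than [t + 1] of these. *)
Let level_sum (t : R) m : 0 <= t ->
  \sum_(k < m) (k%:R < t)%R%:R <= Num.min m%:R (t + 1).
Proof.
move=> t0; elim: m => [|m ih].
  by rewrite big_ord0 le_min lexx/= addr_ge0.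
rewrite big_ord_recr/=; move: ih; rewrite -!natr1.
have m0 : 0 <= m%:R :> R by rewrite ler0n.
rewrite !le_min; case: (ltP m%:R t) => /= mt /andP[? ?]; apply/andP; split; lra.
Qed.

Let open_level n k (f : X -> R) : continuous f ->
  open [set x : X | k%:R < n%:R * f x].
Proof. by move=> cf; apply: open_lt_fun => //; exact: scale_fun_continuous. Qed.

Let mu := riesz_measure.

Let mu_integrable (f : X -> R) : continuous f ->
  mu.-integrable setT (EFin \o f).
Proof.
by apply: continuous_integrable => //; rewrite [X in (X < _)%E]riesz_setT ltry.
Qed.

(** Cut [n * f] into [n] slices of height 1. The [k]-th slice is a minorant of the open set where
    [n * f] exceeds [k], so [L] of it is at most the measure of this set; by [level_sum] the
    indicators of these sets add up to at most [n * f + 1]. *)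
Let slice_le n (f : X -> R) : continuous f -> (forall x, 0 <= f x <= 1) ->
  n%:R * L f <= n%:R * \int[mu]_x f x + 1.
Proof.
move=> cf f01.
have nf0 x : 0 <= n%:R * f x by rewrite mulr_ge0//; have /andP[] := f01 x.
pose s k x : R := Num.min 1 (Num.max 0 (n%:R * f x - k%:R)).
have cs k : continuous (s k).
  move=> x; apply: (@continuous_min R X (fun=> 1)
    (fun x => Num.max 0 (n%:R * f x - k%:R)) x); first exact: cvg_cst.
  apply: (@continuous_max R X (fun=> 0) (fun x => n%:R * f x - k%:R) x).
    exact: cvg_cst.
  by apply: cvgB; [exact: scale_fun_continuous|exact: cvg_cst].
pose U k : set (borel X) := [set x : X | k%:R < n%:R * f x].
have mU k : measurable (U k) by apply: open_borel; exact: open_level.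
rewrite -lee_fin.
have -> : n%:R * L f = \sum_(k < n) L (s k).
  rewrite -L_sum// -LZ//; congr L; apply/funext => x.
  rewrite slice_sum// min_r// ler_piMr ?ler0n//.
  by have /andP[] := f01 x.
rewrite -sumEFin; apply: (@le_trans _ _ (\sum_(k < n) mu (U k))%E).
  apply: lee_sum => k _.
  rewrite /mu /riesz_measure outer_open; last exact: open_level.
  apply: inner_le; split=> // x; rewrite /s.
    by rewrite le_min ler01 le_max lexx ge_min lexx.
  move=> /negP; rewrite -leNgt => fk.
  by rewrite [Num.max _ _]max_l ?subr_le0// min_r.
have ifn : mu.-integrable setT (EFin \o (fun x => n%:R * f x + 1)).
  apply: mu_integrable; apply: add_fun_continuous => //.
  exact: scale_fun_continuous.
have -> : n%:R * \int[mu]_x f x + 1 = \int[mu]_x (n%:R * f x + 1).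
  rewrite RintegralD//; [|exact/mu_integrable/scale_fun_continuous|
    exact/mu_integrable/cstC].
  rewrite RintegralZl//; last exact: mu_integrable.
  by rewrite Rintegral_cst// [X in 1 * fine X]riesz_setT mulr1.
rewrite /Rintegral fineK; last exact: integrable_fin_num.
rewrite (eq_bigr (fun k : 'I_n => \int[mu]_x (\1_(U k) x)%:E)%E); last first.
  by move=> k _; rewrite integral_indic// setIT.
rewrite -ge0_integral_sum//; last first.
  by move=> k; apply/measurable_EFinP; exact: measurable_indic.
apply: ge0_le_integral => //.
- by move=> x _; rewrite sume_ge0.
- apply: (@emeasurable_sum _ (borel X) R) => k; apply/measurable_EFinP.
  exact: measurable_indic.
- by case/integrableP: ifn.
- move=> x _; rewrite sumEFin lee_fin.
  have := level_sum (n%:R * f x) n (nf0 x).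
  rewrite le_min => /andP[_]; apply: le_trans.
  apply: ler_sum => k _; rewrite indicE.
  by have [/set_mem/= ->|_] := boolP (x \in U k).
Qed.

Let slice_limit (f : X -> R) : continuous f -> (forall x, 0 <= f x <= 1) ->
  L f <= \int[mu]_x f x.
Proof.
move=> cf f01; apply/ler_addgt0Pr => e e0.
(* After division the error 1 of [slice_le] becomes [1 / n.+1], which is below [e]. *)
have [n ne] : exists n, e^-1 < n.+1%:R.
  by exists (Num.truncn e^-1); exact: truncnS_gt.
have := slice_le n.+1 _ cf f01.
rewrite -[X in _ + X](@mulfV _ n.+1%:R)// -mulrDr ler_pM2l ?ltr0Sn// => /le_trans.
apply; rewrite lerD2l invf_ple ?posrE ?ltr0Sn// ltW//.
Qed.

Let L_le_integral (f : X -> R) : continuous f -> L f <= \int[mu]_x f x.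
Proof.
move=> cf; have [M M0 fM] := compact_continuous_bounded _ cX cf.
(* This affine change brings the values of [f] from between [- M] and [M] into the unit interval;
   [L] and the integral respect it because both have total mass 1. *)
pose g x := (2 * M)^-1 * (f x + M).
have cfM : continuous (fun x => f x + M) by exact: add_fun_continuous.
have M20 : 0 < 2 * M by rewrite mulr_gt0.
have g01 x : 0 <= g x <= 1.
  have := fM x; rewrite ler_norml => /andP[fM1 fM2].
  rewrite /g mulr_ge0 ?invr_ge0 ?(ltW M20)//=; last lra.
  by rewrite mulrC ler_pdivrMr// mul1r; lra.
have := slice_limit _ (scale_fun_continuous _ _ cfM) g01.
rewrite LZ// (LD f (fun=> M))//.
rewrite RintegralZl//; last exact: mu_integrable.
rewrite RintegralD//; [|exact/mu_integrable|exact/mu_integrable/cstC].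
rewrite Rintegral_cst// [X in M * fine X]riesz_setT mulr1 L_cst.
by rewrite ler_pM2l ?invr_gt0// lerD2r.
Qed.

Let riesz_measureE (f : X -> R) : continuous f -> \int[mu]_x f x = L f.
Proof.
move=> cf; apply/eqP; rewrite eq_le L_le_integral// andbT.
have := L_le_integral _ (scale_fun_continuous (-1) _ cf).
rewrite LZ// RintegralZl//; last exact: mu_integrable.
by rewrite !mulN1r lerN2.
Qed.

Theorem riesz_markov : exists mu : probability (borel X) R,
  forall f, continuous f -> \int[mu]_x f x = L f.
Proof. by exists mu; exact: riesz_measureE. Qed.
End RieszMarkov.

(** * Limits of states and the Choquet boundary *)

(** A bounded family has a cluster point by compactness of the segment, and an ultrafilter converges
    to each of its cluster points. *)
Lemma ultrafilter_bounded_cvg {R : realType} {T : Type} (G : set_system T)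
    (u : T -> R) (M : R) : UltraFilter G -> (forall t, `|u t| <= M) ->
  cvg (u t @[t --> G]).
Proof.
move=> UG uM; have PG : ProperFilter G by exact: ultra_proper.
have [] := @segment_compact R (- M) M (u @ G) (fmap_proper_filter u PG).
  have : \forall t \near G, `[- M, M]%classic (u t).
    by apply: filterE => t; rewrite /= in_itv/= -ler_norml.
  exact.
move=> l [_ cl]; apply/cvg_ex; exists l => A lA.
have [//|GA] := in_ultra_setVsetC (u @^-1` A) UG.
by have [r []] := cl (~` A) A GA lA.
Qed.

Section UltralimitOfStates.
Context {R : realType} {X : topologicalType}.

(** Along one ultrafilter the limits exist for all continuous functions at once, and each property
    of states passes to the limit. Refining [\oo] keeps the ordinary limits. *)
Lemma is_state_ultralimit (l : nat -> (X -> R) -> R) : compact [set: X] ->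
  (forall n, is_state (l n)) ->
  exists G L, [/\ UltraFilter G, \oo `<=` G, is_state L &
    forall f, continuous f -> l n f @[n --> G] --> L f].
Proof.
move=> cX sl; have [G [UG ooG]] := ultraFilterLemma eventually_filter.
have PG : ProperFilter G by exact: ultra_proper.
pose L f := lim (l n f @[n --> G]).
have lL (f : X -> R) : continuous f -> l n f @[n --> G] --> L f.
  move=> cf; have [M M0 fM] := compact_continuous_bounded f cX cf.
  apply: (ultrafilter_bounded_cvg _ _ M UG) => n.
  have cM (a : R) : continuous (fun _ : X => a).
    exact: cst_fun_continuous.
  rewrite ler_norml; apply/andP; split.
    rewrite -(is_state_cst _ (- M) (sl n)).
    apply: is_state_le (sl n) (cM _) cf _ => x.
    by have := fM x; rewrite ler_norml => /andP[].
  rewrite -[leRHS](is_state_cst _ M (sl n)).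
  apply: is_state_le (sl n) cf (cM _) _ => x.
  by have := fM x; rewrite ler_norml => /andP[].
have Ll (f : X -> R) (a : R) : continuous f -> l n f @[n --> G] --> a -> L f = a.
  by move=> cf la; exact: (cvg_lim (@norm_hausdorff _ _) la).
exists G, L; split => //; split.
- move=> f g cf cg; apply: Ll.
    exact: add_fun_continuous.
  under eq_cvg do rewrite (is_stateD (sl _))//.
  by apply: cvgD; exact: lL.
- move=> a f cf; apply: Ll.
    exact: scale_fun_continuous.
  under eq_cvg do rewrite (is_stateZ (sl _))//.
  by apply: cvgM; [exact: cvg_cst|exact: lL].
- move=> f cf f0; apply: limr_ge; first exact: lL.
  by apply: filterE => n; exact: (is_state_ge0 (sl n)).
- apply: Ll; first exact: cst_fun_continuous.
  under eq_cvg do rewrite (is_state1 (sl _)).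
  exact: cvg_cst.
Qed.
End UltralimitOfStates.

(** * Real functions as elements of [cfun R X] *)

Lemma real_cfun_continuous {R : realType} {X : topologicalType} (h : X -> R) :
  continuous h -> continuous (fun x => (h x)%:C%C : R[i]^o).
Proof.
move=> ch x; apply/(@cvgrPdist_lt _ R[i]^o) => e e0.
have eE : (complex.Re e)%:C%C = e by exact/RRe_real/gtr0_real.
have /cvgrPdist_lt/(_ _ _) := ch x; move/(_ (complex.Re e)).
rewrite -ltcR eE => /(_ e0); apply: filterS => y.
by rewrite -rmorphB/= normc_def/= expr0n addr0 sqrtr_sqr -ltcR eE.
Qed.

(* The junk value 0 is taken when [h] is not continuous. *)
HB.lock Definition real_cfun {R : realType} {X : ptopologicalType}
    (h : X -> R) : cfun R X :=
  insubd (0 : cfun R X) (fun x => (h x)%:C%C : R[i]^o).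

Section RealCfun.
Context {R : realType} {X : ptopologicalType}.
Implicit Types (h : X -> R) (f : cfun R X).

Lemma real_cfunE h x : continuous h -> real_cfun h x = (h x)%:C%C.
Proof.
move=> ch; have e : val (real_cfun h) = (fun x => (h x)%:C%C : R[i]^o).
  rewrite real_cfun.unlock; apply: insubdK; apply/mem_set.
  exact: real_cfun_continuous.
by rewrite -[LHS]/(val (real_cfun h) x) e.
Qed.

Lemma real_cfunD (f g : X -> R) : continuous f -> continuous g ->
  real_cfun (fun x => f x + g x) = real_cfun f + real_cfun g.
Proof.
move=> cf cg; apply/continuousEP => x.
rewrite -[RHS]/(real_cfun f x + real_cfun g x).
rewrite !real_cfunE//; first exact: (rmorphD (real_complex R)).
exact: add_fun_continuous.
Qed.

Lemma real_cfunZ a h : continuous h ->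
  real_cfun (fun x => a * h x) = a%:C%C *: real_cfun h.
Proof.
move=> ch; apply/continuousEP => x; rewrite -[RHS]/(a%:C%C * real_cfun h x).
rewrite !real_cfunE//; first exact: (rmorphM (real_complex R)).
exact: scale_fun_continuous.
Qed.

Lemma real_cfun1 : real_cfun (fun=> 1 : R) = 1 :> cfun R X.
Proof.
by apply/continuousEP => x; rewrite real_cfunE//; exact: cst_fun_continuous.
Qed.

Lemma Re_cfun_continuous f : continuous (fun x => complex.Re (f x)).
Proof.
move=> x; apply/cvgrPdist_lt => e e0.
have eC : 0 < e%:C%C :> R[i] by rewrite ltcR.
have /(@cvgrPdist_lt _ R[i]^o)/(_ _ eC) := @cts_fun _ _ f x.
apply: filterS => y; rewrite -ltcR; apply: le_lt_trans.
by rewrite -raddfB; exact: normc_ge_Re.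
Qed.

Lemma Im_cfun_continuous f : continuous (fun x => complex.Im (f x)).
Proof.
move=> x; apply/cvgrPdist_lt => e e0.
have eC : 0 < e%:C%C :> R[i] by rewrite ltcR.
have /(@cvgrPdist_lt _ R[i]^o)/(_ _ eC) := @cts_fun _ _ f x.
apply: filterS => y; rewrite -ltcR; apply: le_lt_trans.
rewrite -raddfB -[X in `|X|]opprK -ReiNIm normrN.
by rewrite (le_trans (normc_ge_Re _))// normrM complexiE normCi mulr1.
Qed.

Lemma cfunDE f g x : (f + g) x = f x + g x. Proof. by []. Qed.
Lemma cfunME f g x : (f * g) x = f x * g x. Proof. by []. Qed.
Lemma cfunZE a f x : (a *: f) x = a * f x. Proof. by []. Qed.

(** The real part is half the sum of [f] and its conjugate, both in [S]; conditions on [S] can thus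
    be tested on real functions. *)
Lemma function_system_Re (S : set (cfun R X)) f : function_system S -> S f ->
  S (real_cfun (fun x => complex.Re (f x))).
Proof.
move=> [SP Sc S1] Sf; have S0 : S 0 by rewrite -(scale0r 1); exact: S1.
have -> : real_cfun (fun x => complex.Re (f x)) =
    2^-1 *: f + (2^-1 *: cfun_conj f + 0).
  apply/continuousEP => x; rewrite real_cfunE; last exact: Re_cfun_continuous.
  rewrite addr0 cfunDE !cfunZE -mulrDr.
  by rewrite -[cfun_conj f x]/((f x)^*%C) addcJ mulKf// pnatr_eq0.
by apply: (SP) => //; apply: (SP) => //; exact: Sc.
Qed.

Lemma function_system_Im (S : set (cfun R X)) f : function_system S -> S f ->
  S (real_cfun (fun x => complex.Im (f x))).
Proof.
move=> fS Sf; have [SP Sc S1] := fS.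
have S0 : S 0 by rewrite -(scale0r 1); exact: S1.
have := function_system_Re _ (- 'i%C *: f + 0) fS (SP _ _ _ Sf S0).
congr (S (real_cfun _)); apply/funext => x.
by rewrite addr0 cfunZE; case: (f x) => a b /=; simpc.
Qed.
End RealCfun.

(** If every [l n h] exceeded [h p + e], the limit [L h] along an ultrafilter would be at least
    [h p + e]. But [L] is evaluation at [p] on [S], so its representing measure is [\d_p] and
    [L h = h p]. *)
Lemma choquet_boundary_limit {R : realType} {X : pointedMetricType R}
    (S : set (cfun R X)) (p : X) (l : nat -> (X -> R) -> R) :
  compact [set: X] -> function_system S -> choquet_boundary S p ->
  (forall n, is_state (l n)) ->
  (forall h, continuous h -> S (real_cfun h) -> l n h @[n --> \oo] --> h p) ->
  forall h e, continuous h -> 0 < e -> exists n, l n h <= h p + e.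
Proof.
move=> cX fS Sp sl lS h e ch e0; apply: contrapT => /forallNP nl.
have [G [L [UG ooG sL lL]]] := is_state_ultralimit l cX sl.
have PG : ProperFilter G by exact: ultra_proper.
have [mu muL] := riesz_markov L cX sL.
have LS g : continuous g -> S (real_cfun g) -> L g = g p.
  move=> cg Sg; apply: (cvg_unique (@norm_hausdorff _ _) (lL _ cg)).
  by apply: cvg_trans (lS _ cg Sg) => A /ooG.
have mup : forall B : set (borel X), measurable B -> mu B = \d_(p : borel X) B.
  apply: Sp => f Sf; rewrite /cintegral.
  rewrite !muL; [|exact: Im_cfun_continuous|exact: Re_cfun_continuous].
  rewrite (LS _ (Re_cfun_continuous f) (function_system_Re S f fS Sf)).
  rewrite (LS _ (Im_cfun_continuous f) (function_system_Im S f fS Sf)).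
  by case: (f p).
have Lh : L h = h p.
  rewrite -muL// /Rintegral (eq_measure_integral \d_(p : borel X)); last first.
    by move=> B mB _; exact: mup.
  rewrite integral_dirac//; last first.
    by apply/measurable_EFinP; exact: borel_measurable_fun.
  by rewrite diracT mul1e.
have : h p + e <= L h.
  apply: (@closed_cvg _ _ G PG (fun n => l n h) [set r | h p + e <= r]).
  - exact: closed_ge.
  - by apply: filterE => n; rewrite /= leNgt; apply/negP => /ltW /(nl n).
  - exact: lL.
by rewrite Lh gerDl leNgt e0.
Qed.

(** * Operators and completely positive maps *)

Section HilbertOperators.
Context {R : realType} {H : hilbertType R}.
Implicit Types (u v w : H) (A B : bop H).

Lemma hdotZl a u v : '[a *: u, v] = a * '[u, v].
Proof. by rewrite -[a *: u]addr0 hdot_linear hdot0l addr0. Qed.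

Lemma hdotZr a u v : '[u, a *: v] = a^* * '[u, v].
Proof. by rewrite hdotC hdotZl rmorphM/= -hdotC. Qed.

Lemma hdotNl u v : '[- u, v] = - '[u, v].
Proof. by rewrite -scaleN1r hdotZl mulN1r. Qed.

Lemma hdotNr u v : '[u, - v] = - '[u, v].
Proof. by rewrite hdotC hdotNl rmorphN/= -hdotC. Qed.

Lemma hdot_cauchy_schwarz u v : `|'[u, v]| <= `|u| * `|v|.
Proof.
have [->|v0] := eqVneq v 0.
  by rewrite hdotC hdot0l rmorph0 !normr0 mulr0.
have b0 : 0 < `|v| ^+ 2 by rewrite exprn_gt0// normr_gt0.
have bJ : (`|v| ^+ 2)^* = `|v| ^+ 2 by apply/CrealP/gtr0_real.
set b := `|v| ^+ 2 in b0 bJ; set a := '[u, v].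
(* This vector is [b] times the component of [u] orthogonal to [v], written without division. *)
have : 0 <= '[b *: u - a *: v, b *: u - a *: v] by rewrite hdotE exprn_ge0.
rewrite hdotDl !hdotDr !hdotNl !hdotNr !hdotZl !hdotZr !hdotE (hdotC v u) -/a -/b.
have -> : b * (b^* * `|u| ^+ 2) + - (b * (a^* * a)) +
  (- (a * (b^* * a^*)) - - (a * (a^* * b))) = b * (b * `|u| ^+ 2 - a * a^*).
  by rewrite bJ; ring.
rewrite pmulr_rge0// -normCK subr_ge0 mulrC -exprMn.
by rewrite ler_pXn2r// nnegrE mulr_ge0.
Qed.

Lemma opnorm_le A (e : R) :
  (forall u, `|u| <= 1 -> `|A u| <= e%:C%C) -> opnorm A <= e.
Proof.
move=> Ae; apply: ge_sup => [|_ [u /= u1 <-]].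
  by exists (complex.Re `|A 0|), 0; rewrite //= normr0 ler01.
by have := Ae u u1; rewrite -RenormE lecR.
Qed.

Lemma le_opnorm A u : `|u| <= 1 -> `|A u| <= (opnorm A)%:C%C.
Proof.
move=> u1; rewrite -RenormE lecR; apply: ub_le_sup; last by exists u.
(* A real [sup] dominates its set only if the set is bounded above, and this is where the continuity
   of [A] enters. *)
have /continuous_linear_bounded/linear_boundedP Ab := @bop_continuous _ _ A 0.
near (pinfty_nbhs R[i]) => r.
have Ar : forall x, `|A x| <= r * `|x| by near: r.
exists (complex.Re `|r|) => _ [v /= v1 <-].
rewrite -lecR !RRe_real ?normr_real//.
have rv0 : 0 <= r * `|v| := le_trans (normr_ge0 _) (Ar v).
rewrite (le_trans (Ar v))// -(ger0_norm rv0) normrM normr_id.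
by rewrite ler_piMr.
Unshelve. all: by end_near. Qed.

Lemma is_adjoint_unique A B B' : is_adjoint A B -> is_adjoint A B' -> B = B'.
Proof.
move=> AB AB'; apply/bopP => v; apply/eqP; rewrite -subr_eq0 -normr_eq0.
rewrite -sqrf_eq0 -hdotE; apply/eqP; set d := B v - B' v.
by rewrite {2}/d hdotDr hdotNr -AB -AB' subrr.
Qed.

Lemma adjointE A B : is_adjoint A B -> adjoint A = B.
Proof.
move=> AB; rewrite /adjoint; case: xgetP => [C _ AC|/(_ B)//].
exact: is_adjoint_unique AC AB.
Qed.

Lemma is_adjointB A A' B B' : is_adjoint A A' -> is_adjoint B B' ->
  is_adjoint (A - B) (A' - B').
Proof.
move=> AA BB u v; rewrite -[(A - B) u]/(A u - B u) -[(A' - B') v]/(A' v - B' v).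
by rewrite hdotDl hdotNl hdotDr hdotNr AA BB.
Qed.
End HilbertOperators.

Section UCP.
Context {R : realType} {X : ptopologicalType} {H : hilbertType R}.
Context (phi : {linear cfun R X -> bop H}) (phi_ucp : ucp phi).
Implicit Types (f g : cfun R X) (u v w : H).

Lemma cfun_conjK : involutive (@cfun_conj R X).
Proof. by move=> f; apply/continuousEP => x; exact: conjCK. Qed.

Lemma cfun_conj1 : cfun_conj 1 = 1 :> cfun R X.
Proof. by apply/continuousEP => x; exact: rmorph1. Qed.

(** The matrix with entries [cfun_conj (f i) * f j] is [G^* G] for the matrix [G] with first row [f]
    and all other rows 0; the size [n.+1] provides the first row. *)
Lemma cp_rank1 n (f : 'I_n.+1 -> cfun R X) (u : 'I_n.+1 -> H) :
  0 <= \sum_i '[\sum_j phi (cfun_conj (f i) * f j) (u j), u i].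
Proof.
pose G : 'M[cfun R X]_n.+1 := \matrix_(k, j) if k == 0 then f j else 0.
have := phi_ucp.2 _ _ (ex_intro _ G erefl) u.
congr (0 <= _); apply: eq_bigr => i _; congr hdot; apply: eq_bigr => j _.
rewrite !mxE (bigD1 0)//= big1 ?addr0 ?mxE//= => k /negPf k0.
by rewrite !mxE k0 mulr0.
Qed.

Lemma cp_ge0 f w : 0 <= '[phi (cfun_conj f * f) w, w].
Proof. by have := cp_rank1 0 (fun=> f) (fun=> w); rewrite !big_ord1. Qed.

(** This is complete positivity for the row [1, f], applied to the pair of vectors [u, v]. *)
Lemma ucp_2x2 f u v : 0 <= '[u, u] + '[phi f v, u] + '[phi (cfun_conj f) u, v] +
  '[phi (cfun_conj f * f) v, v].
Proof.
have := cp_rank1 1 (fun i => if i == 0 then 1 else f)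
  (fun i => if i == 0 then u else v).
rewrite !big_ord_recl !big_ord0/= !addr0 cfun_conj1 !mul1r mulr1 phi_ucp.1.
by rewrite !hdotDl !addrA.
Qed.

(** The nonnegative sum in [ucp_2x2] is real. Its imaginary part vanishes for [v] and for
    ['i%C *: v], which gives the two real equations of the claim. *)
Lemma ucp_adjoint f : is_adjoint (phi f) (phi (cfun_conj f)).
Proof.
move=> v u; rewrite [RHS]hdotC.
have im0 w : complex.Im '[w, w] = 0 by rewrite hdotE ger0_Im// exprn_ge0.
have im1 w : complex.Im '[phi (cfun_conj f * f) w, w] = 0.
  by rewrite ger0_Im// cp_ge0.
have := ger0_Im (ucp_2x2 f u v); have := ger0_Im (ucp_2x2 f u ('i%C *: v)).
rewrite !linearZ/= !hdotZl !hdotZr !raddfD/= !im0.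
rewrite -[('i%C)^*]/(conjc 'i%C) -['[_, _]^*]/(conjc _).
move: '[phi f v, u] '[phi (cfun_conj f) u, v] '[_, _] (im1 v).
move=> [a1 a2] [b1 b2] [c1 c2] /= -> im_i im_1; apply/eqP.
by rewrite eq_complex/=; apply/andP; split; apply/eqP; lra.
Qed.

(** The Kadison-Schwarz inequality: in [ucp_2x2] with [u := - phi f w], the first three terms add up
    to [- |phi f w|^2]. *)
Lemma ucp_schwarz f w : `|phi f w| ^+ 2 <= '[phi (cfun_conj f * f) w, w].
Proof.
have := ucp_2x2 f (- phi f w) w.
have -> : '[phi (cfun_conj f) (- phi f w), w] = - `|phi f w| ^+ 2.
  by rewrite raddfN hdotNl hdotC -ucp_adjoint -hdotC hdotE.
rewrite hdotNl !hdotNr opprK !hdotE.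
by rewrite subrr add0r addrC subr_ge0.
Qed.
End UCP.

(** * Localization at a point *)

Section Localization.
Context {R : realType} {X : pointedMetricType R} {H : hilbertType R}.
Implicit Types (E : pvm X H) (u w : H).

(** [u] is the orthogonal sum of [E B u] and [u - E B u], because [E B] is a self-adjoint
    idempotent. *)
Lemma pvm_norm_le E (B : set (borel X)) u : measurable B -> `|E B u| <= `|u|.
Proof.
move=> mB; set v := u - E B u.
have ort : '[E B u, v] = 0.
  rewrite /v hdotDr hdotNr.
  rewrite {1}(_ : E B u = E B (E B u)) ?pvm_adj ?subrr//.
  by rewrite -[RHS]/((E B * E B) u) -pvmI// setIid.
have := hdot_pythagoras ort.
rewrite [X in '[X, X]](_ : E B u + v = u); last by rewrite /v addrC subrK.
rewrite !hdotE => uE.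
by rewrite -(ler_pXn2r (_ : 0 < 2)%N)// ?nnegrE// uE lerDl exprn_ge0.
Qed.

(** The equation [E B w = w] expresses that [w] lies in the range of the projection [E B]; these
    ranges grow with [B] since [E] is multiplicative on intersections. *)
Lemma pvm_fixedS E (B C : set (borel X)) w : measurable B -> measurable C ->
  B `<=` C -> E B w = w -> E C w = w.
Proof.
move=> mB mC BC Ew; rewrite -{1}Ew -[LHS]/((E C * E B) w) -pvmI//.
by rewrite setIidr.
Qed.

(** For [w] in the range of [E U], the measure [pvm_measure E w] has mass [|w|^2], all of it on
    [U]. *)
Lemma spectral_le (pi : cfun R X -> bop H) E (U : set (borel X)) (h : X -> R)
    (d : R) w :
  compact [set: X] -> is_spectral_measure pi E -> measurable U -> continuous h ->
  (forall x, U x -> h x <= d) -> E U w = w ->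
  complex.Re '[pi (real_cfun h) w, w] <= d * complex.Re `|w| ^+ 2.
Proof.
move=> cX sE mU ch hd Ew; rewrite sE /cintegral/=.
under eq_Rintegral do rewrite real_cfunE//=.
set mu := pvm_measure E w.
have muU : mu U = (complex.Re `|w| ^+ 2)%:E by rewrite /mu /pvm_measure Ew.
have muC : mu (~` U) = 0%E.
  rewrite /mu /pvm_measure -Ew -[E _ (E U w)]/((E (~` U) * E U) w) -pvmI//.
    by rewrite setICl pvm0 normr0 expr0n.
  exact: measurableC.
have ih : mu.-integrable setT (EFin \o h).
  by apply: continuous_integrable => //; exact: ltry.
rewrite -(setUv U) Rintegral_setU//; last 3 first.
- exact: measurableC.
- by rewrite setUv.
- by apply/disj_setPS => x [].
have mh (B : set (borel X)) : measurable B -> measurable_fun B (EFin \o h).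
  move=> mB; apply: (measurable_funS measurableT) => //.
  exact: measurable_int ih.
rewrite [X in _ + X](_ : _ = 0) ?addr0; last first.
  rewrite /Rintegral null_set_integral//; first exact: measurableC.
  by apply: mh; exact: measurableC.
rewrite -[complex.Re _ ^+ 2]/(fine (_%:E)) -muU -Rintegral_cst//.
apply: le_Rintegral => //.
  exact: integrableS ih.
apply: measurable_bounded_integrable => //.
- exact: ltry.
- exact: bounded_cst.
Qed.
End Localization.

Section VectorStates.
Context {R : realType} {X : ptopologicalType} {H : hilbertType R}.
Context (phi : {linear cfun R X -> bop H}) (phi_ucp : ucp phi).

Definition vector_state w (h : X -> R) : R :=
  complex.Re '[phi (real_cfun h) w, w].

Lemma is_state_vector w : `|w| = 1 -> is_state (vector_state w).
Proof.
move=> w1; split => [f g cf cg|a f cf|f cf f0|].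
- by rewrite /vector_state real_cfunD// linearD hdotDl raddfD.
- rewrite /vector_state real_cfunZ// linearZ/= hdotZl; case: '[_, _] => b c /=.
  by rewrite mul0r subr0.
- rewrite /vector_state.
  (* A nonnegative [f] is [cfun_conj g * g] with [g] its square root, the form to which [cp_ge0]
     applies. *)
  have cs : continuous (fun x => Num.sqrt (f x)).
    move=> x; apply: (@continuous_comp _ _ _ f Num.sqrt); first exact: cf.
    exact: sqrt_continuous.
  have -> : real_cfun f = cfun_conj (real_cfun (fun x => Num.sqrt (f x))) *
      real_cfun (fun x => Num.sqrt (f x)).
    apply/continuousEP => x; rewrite [RHS]cfunME.
    rewrite -[cfun_conj _ x]/((real_cfun _ x)^*) !real_cfunE//.
    rewrite -[(_%:C%C)^*]/(conjc _) conjc_real -rmorphM/=.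
    by rewrite -expr2 sqr_sqrtr.
  have := cp_ge0 phi phi_ucp (real_cfun (fun x => Num.sqrt (f x))) w.
  by rewrite lecE => /andP[].
- by rewrite /vector_state real_cfun1 phi_ucp.1 hdotE w1 expr1n.
Qed.
End VectorStates.

Section LocalBehaviour.
Context {R : realType} {X : pointedMetricType R} {H : hilbertType R}.
Context (S : set (cfun R X)) (E : pvm X H).
Context (pi : {lrmorphism cfun R X -> bop H}) (phi : {linear cfun R X -> bop H}).
Hypothesis cX : compact [set: X].
Hypothesis fS : function_system S.
Hypothesis pi_star : star_preserving pi.
Hypothesis piE : is_spectral_measure pi E.
Hypothesis phi_ucp : ucp phi.
Hypothesis phi_pi : forall s, S s -> locally_null E (phi s - pi s).

Lemma bopBE (A B : bop H) w : (A - B) w = A w - B w. Proof. by []. Qed.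

(** On a small neighbourhood, local nullity makes the values of [phi] and [pi] in the state of [w]
    differ by at most [d / 2], and [spectral_le] puts the value of [pi] within [d / 2] of [h p]. *)
Lemma vector_state_near (p : X) (h : X -> R) (d : R) :
  continuous h -> S (real_cfun h) -> 0 < d ->
  exists U, [/\ open U, U p & forall w, `|w| = 1 -> E U w = w ->
    `|h p - vector_state phi w h| <= d].
Proof.
move=> ch Sh d0; have d20 : 0 < d / 2 by rewrite divr_gt0.
have [U [oU Up NU _]] := phi_pi _ Sh p (d / 2) d20.
(* The second condition bounds [h] from below; it is stated for [- 1 * h] because [spectral_le]
   gives upper bounds. *)
pose V := [set x | h x < h p + d / 2] `&` [set x | - 1 * h x < - h p + d / 2].
have cNh : continuous (fun x => - 1 * h x).
  exact: scale_fun_continuous.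
have oV : open V.
  by apply: openI; apply: open_lt_fun => //; exact: cst_fun_continuous.
have oUV : open (U `&` V) by exact: openI.
exists (U `&` V); split; [by []| |move=> w w1 Ew].
  by split => //; split; rewrite /= ?mulN1r ltrDl.
have mUV := open_borel _ oUV.
have EU : E U w = w.
  by apply: (pvm_fixedS E (U `&` V)) => //; exact: open_borel.
have le1 := spectral_le pi E _ h (h p + d / 2) w cX piE mUV ch
  (fun x Ux => ltW Ux.2.1) Ew.
have le2 := spectral_le pi E _ _ (- h p + d / 2) w cX piE mUV cNh
  (fun x Ux => ltW Ux.2.2) Ew.
rewrite w1/= expr1n mulr1 in le1.
rewrite w1/= expr1n mulr1 real_cfunZ// linearZ/= hdotZl in le2.
have phipi : `|complex.Re '[(phi (real_cfun h) - pi (real_cfun h)) w, w]| <= d / 2.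
  rewrite -lecR (le_trans (normc_ge_Re _))//.
  rewrite (le_trans (hdot_cauchy_schwarz _ _))// w1 mulr1.
  rewrite -{1}EU.
  have := @le_opnorm _ _ ((phi (real_cfun h) - pi (real_cfun h)) * E U) w.
  rewrite w1 lexx => /(_ isT) /le_trans; apply.
  by rewrite lecR.
rewrite bopBE hdotDl hdotNl raddfB/= in phipi.
move: le1 le2 phipi; rewrite /vector_state; move: (complex.Re '[phi _ _, _]) => a.
case: '[_, _] => b b' /= le1 le2; rewrite !ler_norml => /andP[? ?].
apply/andP; split; lra.
Qed.

(** Otherwise unit vectors [w n] in the spectral ranges of shrinking balls give states with values
    above [e] at [h]. By [vector_state_near] these states converge on [S] to evaluation at [p], and
    [choquet_boundary_limit] yields a contradiction. *)
Lemma ucp_locally_le (p : X) (h : X -> R) (e : R) : choquet_boundary S p ->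
  continuous h -> h p <= 0 -> 0 < e ->
  exists U, [/\ open U, U p & forall w, E U w = w ->
    complex.Re '[phi (real_cfun h) w, w] <= e * complex.Re `|w| ^+ 2].
Proof.
move=> Sp ch hp e0; apply: contrapT => /forallNP nU.
pose U n : set X := (ball p n.+1%:R^-1)^°.
have pU n : U n p by apply: nbhsx_ballx; rewrite invr_gt0 ltr0Sn.
have oU n : open (U n) by exact: open_interior.
have Uw n : exists w, [/\ `|w| = 1, E (U n) w = w & e < vector_state phi w h].
  (* If no unit vector violates the bound, rescaling gives it for all [w], contrary to [nU]. *)
  have := nU (U n); apply: contra_notP => /forallNP nw; split => // w Ew.
  have [->|w0] := eqVneq w 0.
    by rewrite linear0 hdot0l normr0 expr0n mulr0.
  have nw0 : 0 < complex.Re `|w| by rewrite -ltcR RenormE normr_gt0.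
  rewrite leNgt; apply/negP => ew.
  apply: (nw ((complex.Re `|w|)^-1%:C%C *: w)); split.
  - rewrite normrZ normc_def/= expr0n addr0 sqrtr_sqr -{2}RenormE.
    rewrite gtr0_norm ?invr_gt0// -rmorphM/= mulVf//.
    exact: lt0r_neq0.
  - by rewrite linearZ/= Ew.
  - rewrite /vector_state linearZ/= hdotZl hdotZr.
    rewrite -[_^*]/(conjc _) conjc_real mulrA -rmorphM/=.
    move: ew; case: '[_, _] => a b /= ew; rewrite mul0r subr0.
    by rewrite -expr2 exprVn mulrC ltr_pdivlMr// exprn_gt0.
have [w /all_and3[w1 Ew ew]] := choice Uw.
have [|n] := choquet_boundary_limit S p (fun n => vector_state phi (w n)) cX fS Sp
  (fun n => is_state_vector phi phi_ucp (w n) (w1 n)) _ h e ch e0.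
  move=> g cg Sg; apply/cvgrPdist_le => d d0.
  have [V [oV Vp Vd]] := vector_state_near p g d cg Sg d0.
  (* For large [n] the ball of radius [n.+1%:R^-1] lies in [V], so [w n] is in the range of
     [E V]. *)
  have /nbhs_ballP[r /= r0 rV] : nbhs p V by exact: open_nbhs_nbhs.
  near=> n; apply: Vd => //.
  apply: (pvm_fixedS E (U n)) => //; [exact: open_borel|exact: open_borel|].
  move=> x /interior_subset; rewrite /= => Ux; apply: rV; apply: le_ball Ux.
  near: n; have := near_infty_natSinv_lt (PosNum r0).
  by apply: filterS => n /ltW.
by apply/negP; rewrite -ltNge (le_lt_trans _ (ew n))// gerDr.
Unshelve. all: by end_near. Qed.

(** Both maps are unital, so [f] may be replaced by [g = f - f p]; then [phi g w] and [pi g w] each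
    have norm at most [e / 2] times that of [w]. *)
Lemma locally_small_difference (p : X) f (e : R) : choquet_boundary S p -> 0 < e ->
  exists U, [/\ open U, U p & forall w, E U w = w ->
    `|(phi f - pi f) w| <= e%:C%C * `|w|].
Proof.
move=> Sp e0.
pose g : cfun R X := f - f p *: 1.
pose q := cfun_conj g * g.
pose h x := complex.Re (q x).
have ch : continuous h by exact: Re_cfun_continuous.
have qE x : q x = `|g x| ^+ 2 by rewrite normCK mulrC.
have qh : q = real_cfun h.
  apply/continuousEP => x; rewrite (real_cfunE _ _ ch).
  by apply/esym/RRe_real; rewrite qE realX// normr_real.
have hp : h p = 0.
  by rewrite /h qE -[g p]/(f p - f p * 1) mulr1 subrr normr0 expr0n.
have e20 : 0 < (e / 2) ^+ 2 by rewrite exprn_gt0// divr_gt0.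
have hp0 : h p <= 0 by rewrite hp.
have [U [oU Up Uphi]] := ucp_locally_le p h _ Sp ch hp0 e20.
(* [U] controls the value of [phi] at [|g|^2], and [V] that of [pi]. *)
pose V := [set x | h x < (e / 2) ^+ 2].
have oV : open V by apply: open_lt_fun => //; exact: cst_fun_continuous.
have oUV : open (U `&` V) by exact: openI.
exists (U `&` V); split => // [|w Ew]; first by split; rewrite // /V/= hp.
have mUV := open_borel _ oUV.
have EU : E U w = w.
  by apply: (pvm_fixedS E (U `&` V)) => //; exact: open_borel.
(* The same passage from [|g|^2] to [g] serves [phi], by the Schwarz inequality, and [pi], which is
   multiplicative and star-preserving. *)
have sqrt_le (A : cfun R X -> bop H) : `|A g w| ^+ 2 <= '[A q w, w] ->
    complex.Re '[A (real_cfun h) w, w] <= (e / 2) ^+ 2 * complex.Re `|w| ^+ 2 ->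
    complex.Re `|A g w| <= e / 2 * complex.Re `|w|.
  have Re0 (u : H) : 0 <= complex.Re `|u| by rewrite -ler0c RenormE.
  rewrite -{1}RenormE -rmorphXn/= lecE qh => /andP[_ /=] /le_trans Aw /Aw.
  rewrite -exprMn ler_pXn2r//; rewrite nnegrE ?Re0//.
  by rewrite mulr_ge0// ltW// divr_gt0.
have phig : complex.Re `|phi g w| <= e / 2 * complex.Re `|w|.
  by apply: sqrt_le; [exact: ucp_schwarz|exact: Uphi].
have pig : complex.Re `|pi g w| <= e / 2 * complex.Re `|w|.
  apply: sqrt_le.
    rewrite /q rmorphM -[X in '[X, _]]/(pi (cfun_conj g) (pi g w)).
    by rewrite pi_star cfun_conjK hdotE.
  by apply: (spectral_le _ _ (U `&` V)) => // x [_ /ltW].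
have fE : f = g + f p *: 1 by rewrite subrK.
have phif : phi f w = phi g w + f p *: w.
  by rewrite {1}fE linearD linearZ/= phi_ucp.1.
have pif : pi f w = pi g w + f p *: w by rewrite {1}fE linearD linearZ/= rmorph1.
have -> : (phi f - pi f) w = phi g w - pi g w.
  by rewrite bopBE phif pif opprD addrACA subrr addr0.
apply: le_trans (ler_normB _ _) _.
rewrite -(RenormE (phi g w)) -(RenormE (pi g w)) -(RenormE w).
rewrite -rmorphM -rmorphD/= lecR.
by rewrite [e in leRHS]splitr mulrDl lerD.
Qed.
End LocalBehaviour.

Theorem theorem11p1 (R : realType) (X : pointedMetricType R)
    (S : set (cfun R X)) (H : hilbertType R)
    (pi : {lrmorphism cfun R X -> bop H}) (E : pvm X H)
    (phi : {linear cfun R X -> bop H}) :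
  compact [set: X] ->
  function_system S ->
  separates_points_of S ->
  separable H ->
  star_preserving pi ->
  is_spectral_measure pi E ->
  ucp phi ->
  (forall s, S s -> locally_null E (phi s - pi s)) ->
  (forall p, choquet_boundary S p) ->
  forall f, locally_null E (phi f - pi f).
Proof.
move=> cX fS _ _ pi_star piE phi_ucp phi_pi Sp f p e e0.
have small g := locally_small_difference S E pi phi cX fS pi_star piE phi_ucp
  phi_pi p g e (Sp p) e0.
have [U [oU Up Uf]] := small f.
(* The adjoint of [phi f - pi f] is the same difference for the conjugate of [f], so one estimate
   covers both norms. *)
have [V [oV Vp Vf]] := small (cfun_conj f).
have oUV : open (U `&` V) by exact: openI.
have mU := open_borel _ oU; have mV := open_borel _ oV.
have mUV := open_borel _ oUV.
have Efix u : E (U `&` V) (E (U `&` V) u) = E (U `&` V) u.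
  by rewrite -[LHS]/((E _ * E _) u) -pvmI// setIid.
(* A bound on the range of [E W] becomes an operator norm bound, because the projection of the
   intersection maps into this range without increasing norms. *)
have opnorm_small (A : bop H) (W : set X) : measurable (W : set (borel X)) ->
    U `&` V `<=` W -> (forall w, E W w = w -> `|A w| <= e%:C%C * `|w|) ->
    opnorm (A * E (U `&` V)) <= e.
  move=> mW UVW AW; apply: opnorm_le => u u1.
  rewrite -[(A * _) u]/(A (E (U `&` V) u)).
  apply: (le_trans (AW _ _)); first exact: (pvm_fixedS E (U `&` V)).
  rewrite -[leRHS]mulr1 ler_wpM2l//; first by rewrite ler0c ltW.
  exact: le_trans (pvm_norm_le E _ u mUV) u1.
exists (U `&` V); split => //.
  by apply: (opnorm_small _ U) => //; exact: subIsetl.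
rewrite (adjointE _ (phi (cfun_conj f) - pi (cfun_conj f))).
  by apply: (opnorm_small _ V) => //; exact: subIsetr.
by apply: is_adjointB; [exact: ucp_adjoint|exact: pi_star].
Qed.
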